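(* Let $X\in\mathcal{D}$ have distribution function $F$ and quantile function $Q$, and for $0<v<1$ let $X^*_v$ be a random variable with values in $(0,1)$ and distribution function $$F^*_v(x)=\frac{Q(vx)}{Q(v)},\qquad 0<x<1.$$ Then $X^*_v\leq_{st}X^*_w$ for all $0<v<w<1$ if, and only if, $x\,\tau(x)$ is decreasing for $x>0$, where $\tau(x)=\frac{\mathrm{d}}{\mathrm{d}x}\log F(x)$ is the reversed hazard rate function of $X$.
   Context: For a random variable $X$ with distribution function $F(x)=P(X\le x)$, the quantile function is $Q(u)=\inf\{x\in\mathbb{R}:F(x)\ge u\}$, $0<u<1$, and, if $Q$ is differentiable on $(0,1)$, the quantile density is $q(u)=Q'(u)$, $0<u<1$. $\mathcal{D}$ denotes the family of all absolutely continuous random variables with finite mean whose quantile function satisfies $Q(0)=0$ (where $Q(0):=\lim_{u\downarrow 0}Q(u)$) and whose quantile density exists on $(0,1)$; such random variables are nonnegative with finite nonzero mean. $X\leq_{st}Y$ means $P(X>t)\le P(Y>t)$ for all $t\in\mathbb{R}$. ''Decreasing'' is used in the non-strict sense. The function $\tau$ is considered at the points $x>0$ where $F$ is differentiable. *)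

(* Defs.v *)
From HB Require Import structures.
From mathcomp Require Import all_boot all_order all_algebra.
From mathcomp Require Import all_classical all_reals all_analysis.

Set Implicit Arguments.
Unset Strict Implicit.
Unset Printing Implicit Defensive.

Import Order.TTheory GRing.Theory Num.Theory.
Import numFieldTopology.Exports numFieldNormedType.Exports.

Local Open Scope classical_set_scope.
Local Open Scope ring_scope.

(* The library's [cdf] is extended-real valued; its values lie in [0, 1], so
   [fine] loses nothing. *)
Definition dfun d (T : measurableType d) (R : realType) (P : probability T R)
    (X : {RV P >-> R}) (x : R) : R := fine (cdf X x).

(* Meaningful only for 0 < u < 1: only then is the set nonempty and bounded
   below for every X. *)
Definition quantile d (T : measurableType d) (R : realType)
    (P : probability T R) (X : {RV P >-> R}) (u : R) : R :=
  inf [set x | u <= dfun X x].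

(* [Q(0) = 0] is a condition on the right limit of Q at 0; the value
   [quantile X 0] itself is meaningless (infimum of the whole line). *)
Record class_D d (T : measurableType d) (R : realType) (P : probability T R)
    (X : {RV P >-> R}) : Prop := ClassD {
  class_D_abs_cont : distribution P X `<< @lebesgue_measure R ;
  class_D_finite_mean : (X : T -> R) \in Lfun P 1 ;
  class_D_quantile0 : quantile X u @[u --> 0^'+] --> (0 : R) ;
  class_D_quantile_density :
    forall u : R, 0 < u < 1 -> derivable (quantile X) u 1 }.

(* The two variables may live on different probability spaces. *)
Definition st_le d1 (T1 : measurableType d1) d2 (T2 : measurableType d2)
    (R : realType) (P1 : probability T1 R) (P2 : probability T2 R)
    (X : {RV P1 >-> R}) (Y : {RV P2 >-> R}) : Prop :=
  forall t : R, (ccdf X t <= ccdf Y t)%E.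

Definition reversed_hazard_rate d (T : measurableType d) (R : realType)
    (P : probability T R) (X : {RV P >-> R}) : R -> R :=
  derive1 (fun x => ln (dfun X x)).

(* Main.v *)
Require Import Defs.
From HB Require Import structures.
From mathcomp Require Import all_boot all_order all_algebra.
From mathcomp Require Import all_classical all_reals all_analysis.
From mathcomp Require Import ring lra.

Import Order.TTheory GRing.Theory Num.Theory.
Import numFieldTopology.Exports numFieldNormedType.Exports.

Local Open Scope classical_set_scope.
Local Open Scope ring_scope.

(** Both sides of the equivalence say something about the elasticity
    [E f u = u * f'(u) / f u], the slope of [f] in log-log coordinates.

    The stochastic order between the [Xstar v] says that, for each fixed
    [0 < x < 1], the ratio [Q (v * x) / Q v] is nonincreasing in [v].  Since the
    derivative of [ln (Q v) - ln (Q (x * v))] in [v] is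
    [(E Q v - E Q (x * v)) / v], this holds for all [x] exactly when [E Q] is
    nondecreasing on ]0, 1[ ([ratio_nonincreasingP]).

    On the other side, [x * tau x] is [E F x].  Absolute continuity of [X] and
    continuity of [Q] make [F] and [Q] mutually inverse on the range where
    [0 < F < 1], hence [E F (Q u) = 1 / E Q u] whenever [F] is differentiable at
    [Q u] ([elasticity_dfun_quantile]): [E F] decreases when [E Q] increases.
    Beyond the support [F] is constantly 1, where [E F] vanishes, which is
    harmless because [E F >= 0] at every point of differentiability.

    The delicate point is the converse when the quantile density vanishes at
    some [u]: there [F] is not differentiable at [Q u], so the hypothesis on
    [tau] says nothing about [u], and a priori [E Q u = 0] could break
    monotonicity.  This cannot happen
    ([elasticity_monotone_derive1_gt0]): [Q] is strictly increasing, so the mean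
    value theorem gives points with positive density to the left of [u], and
    monotonicity of [E Q] among such points bounds the slopes of the chords of
    [Q] ending at [u] away from 0. *)

(** * One-sided signs of derivatives, and elasticity *)

Section real_derivatives.
Context {R : realType}.
Implicit Types (f : R -> R) (x l : R).

Lemma is_derive_continuous f x l : is_derive x 1 f l -> {for x, continuous f}.
Proof.
by case=> df _; exact/differentiable_continuous/derivable1_diffP.
Qed.

(** The sign of a derivative can be read along any proper filter converging to
    the point, since Caratheodory's slope function is continuous there.  The two
    one-sided versions below are the instances used. *)
Lemma is_derive_ge0_filter (G : set_system R) {PG : ProperFilter G} f x l :
  G --> x -> is_derive x 1 f l ->
  (\forall z \near G, z != x /\ 0 <= (f z - f x) * (z - x)) -> 0 <= l.
Proof.
move=> Gx /is_derive1_caratheodory[g [fE gx <-]] Gf.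
apply: (@cvgr_to_ge _ G _ R g (g x)).
  by apply: cvg_trans gx; exact: cvg_app.
near=> z; have [zx fz] : z != x /\ 0 <= (f z - f x) * (z - x) by near: z.
move: fz; rewrite fE -mulrA pmulr_lge0// -expr2 exprn_even_gt0//=.
by rewrite subr_eq0.
Unshelve. all: by end_near. Qed.

Lemma is_derive_ge0_left f x l : is_derive x 1 f l ->
  (\forall z \near x^'-, f z <= f x) -> 0 <= l.
Proof.
move=> fl fx; apply: (is_derive_ge0_filter (x^'-) f x l _ fl).
  exact: cvg_within.
near=> z.
have zx : z < x by near: z; exact: nbhs_left_lt.
rewrite lt_eqF//; split=> //; apply: mulr_le0; last by rewrite subr_le0 ltW.
by rewrite subr_le0; near: z.
Unshelve. all: by end_near. Qed.

Lemma is_derive_le0_right f x l : is_derive x 1 f l ->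
  (\forall z \near x^'+, f z <= f x) -> l <= 0.
Proof.
move=> fl fx; rewrite -oppr_ge0.
apply: (is_derive_ge0_filter (x^'+) (- f) x (- l)).
  exact: cvg_within.
near=> z.
have zx : x < z by near: z; exact: nbhs_right_gt.
rewrite gt_eqF//; split=> //; apply: mulr_ge0; last by rewrite subr_ge0 ltW.
by rewrite -[leRHS]/(- f z - - f x) opprK addrC subr_ge0; near: z.
Unshelve. all: by end_near. Qed.

Definition elasticity f u := u * derive1 f u / f u.

Lemma is_derive_ln_comp f x : 0 < f x -> derivable f x 1 ->
  is_derive x 1 (fun t => ln (f t)) (derive1 f x / f x).
Proof.
move=> fx0 df; rewrite mulrC derive1E.
exact: (@is_derive1_comp _ (@ln R) f x _ _ (is_derive1_ln fx0) (derivableP df)).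
Qed.

Lemma elasticity_ln f x : 0 < f x -> derivable f x 1 ->
  x * derive1 (fun t => ln (f t)) x = elasticity f x.
Proof.
move=> fx0 df; have [_ ] := is_derive_ln_comp f x fx0 df.
by rewrite -derive1E => ->; rewrite /elasticity mulrA.
Qed.

Lemma is_derive_scalel (c v : R) : is_derive v 1 (fun t => c * t) c.
Proof.
have -> : (fun t => c * t) = c \*: (@id R) by apply/funext.
have := @is_deriveZ R R R id c v 1 1 (is_derive_id _ _).
by rewrite /GRing.scale/= mulr1.
Qed.

End real_derivatives.

(** * Monotone elasticity and dilation ratios *)

Section elasticity.
Context {R : realType} (f : R -> R).
Implicit Types t u v w x : R.
Hypothesis f_gt0 : forall u, 0 < u < 1 -> 0 < f u.
Hypothesis f_derivable : forall u, 0 < u < 1 -> derivable f u 1.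

Let scale01 (x t : R) : 0 < x < 1 -> 0 < t < 1 -> 0 < x * t < 1.
Proof.
move=> /andP[x0 x1] /andP[t0 t1]; rewrite mulr_gt0//=.
by apply: mulr_ilt1 => //; exact: ltW.
Qed.

Lemma is_derive_ln_ratio x t : 0 < x < 1 -> 0 < t < 1 ->
  is_derive t 1 (fun s => ln (f s) - ln (f (x * s)))
    ((elasticity f t - elasticity f (x * t)) / t).
Proof.
move=> x01 t01; have xt01 := scale01 x t x01 t01.
have /andP[t0 _] := t01.
have d1 := is_derive_ln_comp f t (f_gt0 t t01) (f_derivable t t01).
have d2 := is_derive_ln_comp f (x * t) (f_gt0 _ xt01) (f_derivable _ xt01).
have d3 := @is_derive1_comp _ _ (fun s => x * s) t _ _ d2 (is_derive_scalel x t).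
have -> : (elasticity f t - elasticity f (x * t)) / t =
    derive1 f t / f t - derive1 f (x * t) / f (x * t) * x.
  rewrite /elasticity; field.
  by rewrite !gt_eqF ?f_gt0.
exact: (@is_deriveB _ _ _ _ _ _ _ _ _ d1 d3).
Qed.

(** Given [v < w], the left-to-right implication looks at the dilation factor
    [x = v / w], for which the derivative of the log-ratio at [w] compares
    exactly [elasticity f v] with [elasticity f w]. *)
Lemma ratio_nonincreasingP :
  (forall v w x, 0 < v -> v < w -> w < 1 -> 0 < x < 1 ->
     f (w * x) / f w <= f (v * x) / f v) <->
  (forall v w, 0 < v -> v < w -> w < 1 -> elasticity f v <= elasticity f w).
Proof.
have lnE t x : 0 < x < 1 -> 0 < t < 1 ->
    ln (f t) - ln (f (x * t)) = - ln (f (t * x) / f t).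
  move=> x01 t01; rewrite (mulrC t x) ln_div ?posrE ?f_gt0 ?scale01//.
  by rewrite opprB.
split=> [ratio v w v0 vw w1|mono v w x v0 vw w1 x01].
  have w0 := lt_trans v0 vw.
  have w01 : 0 < w < 1 by rewrite w0.
  have x01 : 0 < v / w < 1 by rewrite divr_gt0//= ltr_pdivrMr// mul1r.
  have D := is_derive_ln_ratio (v / w) w x01 w01.
  have vE : v = v / w * w by rewrite divfK ?gt_eqF.
  rewrite {1}vE -subr_ge0 -(@pmulr_lge0 _ w^-1) ?invr_gt0//.
  apply: (is_derive_ge0_left _ _ _ D).
  near=> t.
  have t0 : 0 < t by near: t; exact: nbhs_left_gt.
  have tw : t < w by near: t; exact: nbhs_left_lt.
  have t01 : 0 < t < 1 by rewrite t0 (lt_trans tw).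
  have wx01 : 0 < w * (v / w) < 1 by rewrite mulrC scale01.
  have tx01 : 0 < t * (v / w) < 1 by rewrite mulrC scale01.
  by rewrite !lnE// lerN2 ler_ln ?posrE ?divr_gt0 ?f_gt0// ratio.
have w0 := lt_trans v0 vw.
have v01 : 0 < v < 1 by rewrite v0 (lt_trans vw).
have w01 : 0 < w < 1 by rewrite w0.
rewrite -ler_ln ?posrE ?divr_gt0 ?f_gt0 ?(mulrC _ x) ?scale01//.
rewrite !(mulrC x) -lerN2 -!lnE//.
have D t : t \in `]0, 1[ -> is_derive t 1 (fun s => ln (f s) - ln (f (x * s)))
    ((elasticity f t - elasticity f (x * t)) / t).
  by rewrite in_itv/=; exact: is_derive_ln_ratio.
apply: (@ger0_derive1_le_oo _ (fun s => ln (f s) - ln (f (x * s))) 0 1) => //.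
- by move=> t /D[].
- move=> t t01; rewrite derive1E; have [_ ->] := D t t01.
  move: t01; rewrite in_itv/= => t01; have /andP[xt0 _] := scale01 x t x01 t01.
  have /andP[x0 x1] := x01; have /andP[t0 t1] := t01.
  by rewrite pmulr_lge0 ?invr_gt0// subr_ge0 mono// gtr_pMl.
- by move=> t; rewrite inE => t01; exact: is_derive_continuous (D t t01).
- exact: ltW.
Unshelve. all: by end_near. Qed.

Hypothesis f_incr : forall u w, 0 < u -> u < w -> w < 1 -> f u < f w.

Let f_MVT u w : 0 < u -> u < w -> w < 1 ->
  exists2 c, u < c < w & f w - f u = derive1 f c * (w - u) /\ 0 < derive1 f c.
Proof.
move=> u0 uw w1.
have D t : t \in `[u, w] -> is_derive t 1 f (derive1 f t).
  rewrite in_itv/= => /andP[ut tw]; rewrite derive1E; apply: derivableP.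
  by apply: f_derivable; rewrite (lt_le_trans u0)//= (le_lt_trans tw).
have D' t : t \in `]u, w[ -> is_derive t 1 f (derive1 f t).
  by move=> tuw; apply: D; exact: subset_itv_oo_cc tuw.
have C : {within `[u, w], continuous f}.
  by apply: derivable_within_continuous => t /D[].
have [c cuw fE] :
    exists2 c, c \in `]u, w[%R & f w - f u = derive1 f c * (w - u).
  exact: (@MVT R f (derive1 f) u w uw D' C).
move: cuw; rewrite in_itv/= => cuw; exists c => //; split=> //.
by rewrite -(@pmulr_lgt0 _ (w - u)) ?subr_gt0// -fE subr_gt0 f_incr.
Qed.

(** Vanishing of the derivative of a strictly increasing function at [u] is
    excluded by monotonicity of the elasticity on the set where the derivative
    is positive.  Pick [c < u] in that set.  Every chord from [t] in ]c, u[ to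
    [u] has its slope attained as a derivative at some [e] in that set, so
    [E f e >= E f c], and therefore the slope [E f e * f e / e] is at least
    [m = E f c * f c / u]; this lower bound passes to the limit [t -> u]. *)
Lemma elasticity_monotone_derive1_gt0 :
  (forall u w, 0 < u -> u < w -> w < 1 ->
     0 < derive1 f u -> 0 < derive1 f w -> elasticity f u <= elasticity f w) ->
  forall u, 0 < u < 1 -> 0 < derive1 f u.
Proof.
move=> mono u /andP[u0 u1].
have [| |//|c /andP[uc cu] [_ dc]] := f_MVT (u / 2) u; [lra|lra|].
have c0 : 0 < c by lra.
have fc : 0 < f c by apply: f_gt0; rewrite c0 (lt_trans cu).
pose m := elasticity f c * f c / u.
have m0 : 0 < m by rewrite !(divr_gt0, mulr_gt0).
apply: (lt_le_trans m0); rewrite -subr_ge0.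
have D : is_derive u 1 (fun t => f t - m * t) (derive1 f u - m).
  apply: (@is_deriveB _ _ _ f (fun t => m * t) u 1 (derive1 f u) m).
    rewrite derive1E; apply: derivableP; apply: f_derivable.
    by rewrite u0.
  exact: is_derive_scalel.
apply: (is_derive_ge0_left _ _ _ D); near=> t.
have ct : c < t by near: t; exact: nbhs_left_gt.
have tu : t < u by near: t; exact: nbhs_left_lt.
have t0 := lt_trans c0 ct.
have [e /andP[te eu] [fE de]] := f_MVT t u t0 tu u1.
rewrite -subr_ge0.
have -> : f u - m * u - (f t - m * t) = (derive1 f e - m) * (u - t).
  by rewrite mulrBl -fE; ring.
apply: mulr_ge0; last by rewrite subr_ge0 ltW.
rewrite subr_ge0.
have e0 := lt_trans t0 te; have ce := lt_trans ct te.
have e1 := lt_trans eu u1.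
have fe : 0 < f e by apply: f_gt0; rewrite e0.
have -> : derive1 f e = elasticity f e * f e / e.
  by rewrite /elasticity; field; rewrite !gt_eqF.
have Ec0 : 0 <= elasticity f c by rewrite ltW// divr_gt0// mulr_gt0.
apply: ler_pM; last by rewrite lef_pV2 ?posrE// ltW.
- by apply: mulr_ge0 => //; exact: ltW.
- by rewrite invr_ge0 ltW.
- by apply: ler_pM; [|exact: ltW|exact: mono|rewrite ltW// f_incr].
Unshelve. all: by end_near. Qed.

End elasticity.

(** * Distribution functions and their quantiles *)

Section distribution_function.
Context {R : realType} {d : measure_display} {T : measurableType d}
  {P : probability T R} (X : {RV P >-> R}).
Implicit Types t u w x y : R.

Lemma dfunE x : (dfun X x)%:E = cdf X x.
Proof. by rewrite /dfun fineK// fin_num_measure. Qed.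

Lemma dfun_nondecreasing : nondecreasing_fun (dfun X).
Proof. by move=> x y xy; rewrite -lee_fin !dfunE cdf_nondecreasing. Qed.

Lemma dfun_ge0 x : 0 <= dfun X x.
Proof. by rewrite -lee_fin dfunE cdf_ge0. Qed.

Lemma dfun_le1 x : dfun X x <= 1.
Proof. by rewrite -lee_fin dfunE cdf_le1. Qed.

Lemma cvg_dfun {G : set_system R} {FG : Filter G} (l : R) :
  cdf X x @[x --> G] --> l%:E -> dfun X x @[x --> G] --> l.
Proof. exact: fine_cvg. Qed.

Lemma le_dfun_right u x : (forall y, x < y -> u <= dfun X y) -> u <= dfun X x.
Proof.
move=> uF; have := @cdf_right_continuous _ _ _ _ X x.
rewrite -dfunE => /cvg_dfun/cvgr_to_ge; apply.
by near=> y; apply: uF; near: y; exact: nbhs_right_gt.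
Unshelve. all: by end_near. Qed.

(** The Galois connection between [quantile X] and [dfun X]: the infimum
    defining the quantile is attained because [dfun X] is right-continuous, and
    it is over a nonempty set bounded below because of the limits of [dfun X] at
    infinity. *)
Lemma quantile_le u x : 0 < u < 1 -> (quantile X u <= x) = (u <= dfun X x).
Proof.
move=> /andP[u0 u1].
have [a Fa] : exists a, dfun X a < u.
  have /cvg_dfun/cvgr_lt/(_ u u0)[a [_ aF]] := @cvg_cdfNy0 _ _ _ _ X.
  by exists (a - 1); apply: aF; rewrite ltrBlDr ltrDl.
have [b Fb] : exists b, u <= dfun X b.
  have /cvg_dfun/cvgr_ge/(_ u u1)[b [_ bF]] := @cvg_cdfy1 _ _ _ _ X.
  by exists (b + 1); apply: bF; rewrite ltrDl.
apply/idP/idP => [Qx|Fx].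
  apply: le_dfun_right => y xy.
  have [|z uz zy] := inf_lt _ (le_lt_trans Qx xy); first by exists b.
  by apply: (le_trans uz); exact/dfun_nondecreasing/ltW.
apply: ge_inf => //; exists a => z /= uz; rewrite leNgt; apply/negP => za.
have := lt_le_trans Fa uz.
by rewrite ltNge dfun_nondecreasing// ltW.
Qed.

(** Left continuity of [dfun X]: the law of [X] has no atoms, so [dfun X x] is
    also the mass of the open half-line, an increasing union of closed
    half-lines with endpoints below [x]. *)
Lemma dfun_le_left u x : distribution P X `<< @lebesgue_measure R ->
  (forall y, y < x -> dfun X y <= u) -> dfun X x <= u.
Proof.
move=> ac Fu.
have Xx0 : distribution P X [set x] = 0%E.
  apply: ((null_content_dominatesP _ _).1 ac) => //.
  exact: lebesgue_measure_set1.
have -> : dfun X x = fine (distribution P X `]-oo, x[).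
  rewrite /dfun /cdf -(@setUitv1 _ _ -oo%O x true)//.
  by rewrite measureU0.
pose E n := `]-oo, x - n.+1%:R^-1]%classic : set R.
have EU : \bigcup_n E n = `]-oo, x[%classic.
  apply/seteqP; split=> [y [n _]|y]; rewrite /E/= !in_itv/=.
    by move=> /le_lt_trans; apply; rewrite ltrBlDr ltrDl.
  by move=> /ltr_add_invr[n yn]; exists n; rewrite //= in_itv/= lerBrDr ltW.
have mE n : measurable (E n) by exact: measurable_itv.
have : distribution P X (E n) @[n --> \oo] --> distribution P X (\bigcup_n E n).
  apply: nondecreasing_cvg_mu => //; first exact: bigcup_measurable.
  move=> n m nm; apply/subsetPset => y; rewrite /E/= !in_itv/= => /le_trans.
  by apply; rewrite lerB// lef_pV2 ?ler_nat ?posrE.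
rewrite EU -[X in _ --> X](@fineK _ (distribution P X `]-oo, x[)); last first.
  exact: fin_num_measure.
move=> /fine_cvg/cvgr_to_le; apply.
by apply: nearW => n; apply: Fu; rewrite ltrBlDr ltrDl.
Qed.

Lemma dfun_le0 x : (forall s, 0 < X s) -> x <= 0 -> dfun X x = 0.
Proof.
move=> X0 x0; rewrite /dfun /cdf /distribution /pushforward.
rewrite (_ : X @^-1` _ = set0) ?measure0//.
apply/seteqP; split=> // s /=; rewrite in_itv/= => Xx.
by have := lt_le_trans (X0 s) (le_trans Xx x0); rewrite ltxx.
Qed.

Lemma dfun_ge1 x : (forall s, X s < 1) -> 1 <= x -> dfun X x = 1.
Proof.
move=> X1 x1; rewrite /dfun /cdf /distribution /pushforward.
rewrite (_ : X @^-1` _ = setT) ?probability_setT//.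
apply/seteqP; split=> // s _ /=; rewrite in_itv/=.
exact: le_trans (ltW (X1 s)) x1.
Qed.

End distribution_function.

Lemma st_leP (R : realType) d1 (T1 : measurableType d1) d2
    (T2 : measurableType d2) (P1 : probability T1 R) (P2 : probability T2 R)
    (X : {RV P1 >-> R}) (Y : {RV P2 >-> R}) :
  st_le X Y <-> forall t, dfun Y t <= dfun X t.
Proof.
have E t : (ccdf X t <= ccdf Y t)%E = (dfun Y t <= dfun X t).
  by rewrite !ccdf_1_cdf -!dfunE -!EFinB lee_fin lerD2l lerN2.
by split=> XY t; [rewrite -E|rewrite E].
Qed.

(** * Duality between distribution and quantile elasticities *)

Section class_D_theory.
Context {R : realType} {d : measure_display} {T : measurableType d}
  {P : probability T R} (X : {RV P >-> R}).
Hypothesis XD : class_D X.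
Implicit Types t u w x y : R.
Local Notation F := (dfun X).
Local Notation Q := (quantile X).

(** One inequality is right continuity of [dfun X], the other is the absence of
    atoms. *)
Lemma dfun_quantile u : 0 < u < 1 -> F (Q u) = u.
Proof.
move=> u01; apply/eqP; rewrite eq_le -[X in _ && X]quantile_le// lexx andbT.
apply: dfun_le_left => [|y yQ]; first exact: class_D_abs_cont XD.
by rewrite leNgt; apply/negP => /ltW; rewrite -quantile_le// leNgt yQ.
Qed.

Lemma quantile_incr u w : 0 < u -> u < w -> w < 1 -> Q u < Q w.
Proof.
move=> u0 uw w1.
have u01 : 0 < u < 1 by rewrite u0 (lt_trans uw).
have w01 : 0 < w < 1 by rewrite (lt_trans u0).
rewrite lt_neqAle quantile_le// dfun_quantile// (ltW uw) andbT.
apply/eqP => QE; move: uw.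
by rewrite -(dfun_quantile u u01) QE dfun_quantile// ltxx.
Qed.

Lemma quantile_gt0 u : 0 < u < 1 -> 0 < Q u.
Proof.
move=> /andP[u0 u1]; apply: (@le_lt_trans _ _ (Q (u / 2))); last first.
  by apply: quantile_incr => //; lra.
apply: (cvgr_to_le (class_D_quantile0 XD)); near=> t.
apply/ltW/quantile_incr; [|near: t; apply: nbhs_right_lt|]; last 2 first.
- by lra.
- by lra.
by near: t; exact: nbhs_right_gt.
Unshelve. all: by end_near. Qed.

Lemma dfun_gt0 x : 0 < x -> 0 < F x.
Proof.
move=> x0.
suff [u [u01 Qx]] : exists u, 0 < u < 1 /\ Q u < x.
  have /andP[u0 _] := u01.
  by apply: (lt_le_trans u0); rewrite -quantile_le// ltW.
near (0 : R)^'+ => u; exists u; split.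
  by apply/andP; split; near: u; [exact: nbhs_right_gt|exact: nbhs_right_lt].
near: u; exact: (cvgr_lt _ (class_D_quantile0 XD)).
Unshelve. all: by end_near. Qed.

Lemma quantile_is_derive u : 0 < u < 1 -> is_derive u 1 Q (derive1 Q u).
Proof.
move=> u01; rewrite derive1E; apply: derivableP.
exact: class_D_quantile_density.
Qed.

Lemma quantile_continuous u : 0 < u < 1 -> {for u, continuous Q}.
Proof. by move=> /quantile_is_derive/is_derive_continuous. Qed.

(** [dfun X] is strictly increasing where it lies in ]0, 1[, because a flat piece
    would be a jump of [quantile X], which is continuous there. *)
Lemma quantile_dfun x : 0 < F x < 1 -> Q (F x) = x.
Proof.
move=> F01; have /andP[F0 F1] := F01.
apply/eqP; rewrite eq_le quantile_le// lexx/= leNgt; apply/negP => Qx.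
near (F x)^'+ => t.
have Ft : F x < t by near: t; exact: nbhs_right_gt.
have t1 : t < 1 by near: t; exact: nbhs_right_lt.
have Qt : Q t < x.
  near: t; apply: cvg_within; exact: (cvgr_lt _ (quantile_continuous _ F01)).
move: Ft; rewrite ltNge -quantile_le ?(ltW Qt)//.
by rewrite t1 (lt_trans F0).
Unshelve. all: by end_near. Qed.

Let near01 u : 0 < u < 1 -> \forall t \near u, 0 < t < 1.
Proof.
move=> /andP[u0 u1]; near=> t; apply/andP; split; near: t.
- exact: lt_nbhsr.
- exact: lt_nbhsl.
Unshelve. all: by end_near. Qed.

Lemma derivable_dfun_quantile u : 0 < u < 1 -> 0 < derive1 Q u ->
  derivable F (Q u) 1.
Proof.
move=> u01 q0.
have [//] : is_derive (Q u) 1 F (derive1 Q u)^-1.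
apply: is_derive_inverse (quantile_is_derive _ u01) _; last by rewrite gt_eqF.
- by near=> t; apply: dfun_quantile; near: t; exact: near01.
- by near=> t; apply: quantile_continuous; near: t; exact: near01.
Unshelve. all: by end_near. Qed.

(** Differentiability of [dfun X] at [quantile X u] forces the quantile density
    at [u] to be positive, since the two derivatives have product 1. *)
Lemma elasticity_dfun_quantile u : 0 < u < 1 -> derivable F (Q u) 1 ->
  0 < derive1 Q u /\ elasticity F (Q u) = (elasticity Q u)^-1.
Proof.
move=> u01 dF.
have dFQ : derive1 F (Q u) * derive1 Q u = 1.
  have D1 : is_derive u 1 (F \o Q) (derive1 F (Q u) * derive1 Q u).
    apply: is_derive1_comp (quantile_is_derive _ u01).
    by rewrite derive1E; exact: derivableP.
  have D2 : is_derive u 1 (F \o Q) 1.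
    apply: near_eq_is_derive (is_derive_id _ _).
    by near=> t; rewrite /= dfun_quantile//; near: t; exact: near01.
  by case: D1 => _ <-; case: D2.
have q0 : derive1 Q u != 0.
  apply/eqP => q0; move: dFQ; rewrite q0 mulr0 => /eqP.
  by rewrite eq_sym oner_eq0.
split.
  rewrite lt_neqAle eq_sym q0/=.
  apply: (is_derive_ge0_left _ _ _ (quantile_is_derive _ u01)).
  have /andP[u0 u1] := u01.
  near=> t.
  have t0 : 0 < t by near: t; exact: nbhs_left_gt.
  have tu : t < u by near: t; exact: nbhs_left_lt.
  exact/ltW/quantile_incr.
have F'E : derive1 F (Q u) = (derive1 Q u)^-1.
  by rewrite -[RHS]mul1r -dFQ mulfK.
have /andP[u0 _] := u01; rewrite /elasticity F'E dfun_quantile//; field.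
by rewrite q0 !gt_eqF// quantile_gt0.
Unshelve. all: by end_near. Qed.

Lemma reversed_hazard_elasticity x : 0 < x -> derivable F x 1 ->
  x * reversed_hazard_rate X x = elasticity F x.
Proof. by move=> x0; exact/elasticity_ln/dfun_gt0. Qed.

Lemma elasticity_dfun_ge0 x : 0 < x -> derivable F x 1 -> 0 <= elasticity F x.
Proof.
move=> x0 dF; rewrite divr_ge0 ?dfun_ge0//; apply: mulr_ge0; first exact: ltW.
apply: (is_derive_ge0_left F x); first by rewrite derive1E; exact: derivableP.
by near=> t; apply: dfun_nondecreasing; near: t; exact: nbhs_left_le.
Unshelve. all: by end_near. Qed.

(** [dfun X] is at its maximum at such an [x], so its right slopes are
    nonpositive. *)
Lemma elasticity_dfun_le0 x : 0 < x -> derivable F x 1 -> F x = 1 ->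
  elasticity F x <= 0.
Proof.
move=> x0 dF Fx1; rewrite /elasticity Fx1 divr1 pmulr_rle0//.
apply: (is_derive_le0_right F x); first by rewrite derive1E; exact: derivableP.
by near=> t; rewrite Fx1 dfun_le1.
Unshelve. all: by end_near. Qed.

Lemma elasticity_quantile_gt0 u : 0 < u < 1 -> 0 < derive1 Q u ->
  0 < elasticity Q u.
Proof.
move=> /[dup] u01 /andP[u0 _] q0.
by rewrite divr_gt0 ?mulr_gt0// quantile_gt0.
Qed.

Lemma reversed_hazard_decreasingP :
  (forall u w, 0 < u -> u < w -> w < 1 -> elasticity Q u <= elasticity Q w) <->
  (forall x y, 0 < x -> x <= y -> derivable F x 1 -> derivable F y 1 ->
     y * reversed_hazard_rate X y <= x * reversed_hazard_rate X x).
Proof.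
split=> [mono x y x0 xy dx dy|rh].
  have y0 := lt_le_trans x0 xy.
  rewrite !reversed_hazard_elasticity//.
  have [->//|xNy] := eqVneq x y.
  (* At or beyond the right endpoint of the support the quantile is of no use;
     the sign of the elasticity settles that case. *)
  have [Fy1|Fy1] := leP 1 (F y).
    have Fy : F y = 1 by apply/eqP; rewrite eq_le dfun_le1.
    by rewrite (le_trans (elasticity_dfun_le0 _ y0 dy Fy))// elasticity_dfun_ge0.
  have Fxy := dfun_nondecreasing X _ _ xy.
  have Fx0 := dfun_gt0 _ x0.
  have Fx01 : 0 < F x < 1 by rewrite Fx0 (le_lt_trans Fxy).
  have Fy01 : 0 < F y < 1 by rewrite Fy1 (lt_le_trans Fx0).
  have QFx := quantile_dfun _ Fx01; have QFy := quantile_dfun _ Fy01.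
  move: dx dy; rewrite -{1}QFx -{1}QFy => dx dy.
  have [qx Ex] := elasticity_dfun_quantile _ Fx01 dx.
  have [qy Ey] := elasticity_dfun_quantile _ Fy01 dy.
  rewrite -QFx -QFy Ex Ey lef_pV2 ?posrE ?elasticity_quantile_gt0//.
  apply: mono => //; rewrite lt_neqAle Fxy andbT.
  by apply/eqP => FE; move: xNy; rewrite -QFx FE QFy eqxx.
(* Among points of positive quantile density the hypothesis transfers through
   [quantile X]; the point of the rest is that there are no others. *)
have mono u w : 0 < u -> u < w -> w < 1 -> 0 < derive1 Q u -> 0 < derive1 Q w ->
    elasticity Q u <= elasticity Q w.
  move=> u0 uw w1 qu qw.
  have u01 : 0 < u < 1 by rewrite u0 (lt_trans uw).
  have w01 : 0 < w < 1 by rewrite (lt_trans u0).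
  have du := derivable_dfun_quantile _ u01 qu.
  have dw := derivable_dfun_quantile _ w01 qw.
  have Qu0 := quantile_gt0 _ u01.
  have Quw := quantile_incr _ _ u0 uw w1.
  have := rh _ _ Qu0 (ltW Quw) du dw.
  have Qw0 := lt_trans Qu0 Quw; rewrite !reversed_hazard_elasticity//.
  have [_ ->] := elasticity_dfun_quantile _ u01 du.
  have [_ ->] := elasticity_dfun_quantile _ w01 dw.
  by rewrite lef_pV2 ?posrE ?elasticity_quantile_gt0.
have q_gt0 := elasticity_monotone_derive1_gt0 Q quantile_gt0
  (class_D_quantile_density XD) quantile_incr mono.
move=> u w u0 uw w1; apply: mono => //; apply: q_gt0.
  by rewrite u0 (lt_trans uw).
by rewrite (lt_trans u0).
Qed.

End class_D_theory.

(** * Stochastic monotonicity *)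

Theorem proposition11 (R : realType)
    (d : measure_display) (T : measurableType d) (P : probability T R)
    (X : {RV P >-> R})
    (dstar : R -> measure_display)
    (Tstar : forall v : R, measurableType (dstar v))
    (Pstar : forall v : R, probability (Tstar v) R)
    (Xstar : forall v : R, {RV (Pstar v) >-> R})
    (XD : class_D X)
    (Xstar01 : forall v : R, 0 < v < 1 ->
       forall w : Tstar v, 0 < Xstar v w < 1)
    (XstarF : forall v : R, 0 < v < 1 -> forall x : R, 0 < x < 1 ->
       dfun (Xstar v) x = quantile X (v * x) / quantile X v) :
  (forall v w : R, 0 < v -> v < w -> w < 1 -> st_le (Xstar v) (Xstar w)) <->
  (forall x y : R, 0 < x -> x <= y ->
     derivable (dfun X) x 1 -> derivable (dfun X) y 1 ->
     y * reversed_hazard_rate X y <= x * reversed_hazard_rate X x).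
Proof.
apply: iff_trans (reversed_hazard_decreasingP X XD).
apply: iff_trans (ratio_nonincreasingP (quantile X) (quantile_gt0 X XD)
  (class_D_quantile_density XD)).
split=> [st v w x v0 vw w1 x01|ratio v w v0 vw w1].
  have v01 : 0 < v < 1 by rewrite v0 (lt_trans vw).
  have w01 : 0 < w < 1 by rewrite (lt_trans v0).
  by rewrite -!XstarF//; move: x {x01}; apply/st_leP/st.
have v01 : 0 < v < 1 by rewrite v0 (lt_trans vw).
have w01 : 0 < w < 1 by rewrite (lt_trans v0).
(* Outside ]0, 1[ the two distribution functions are both 0 or both 1. *)
apply/st_leP => t; have [t0|t0] := leP t 0.
  rewrite !dfun_le0// => s.
    by have /andP[] := Xstar01 v v01 s.
  by have /andP[] := Xstar01 w w01 s.
have [t1|t1] := leP 1 t.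
  rewrite !dfun_ge1// => s.
    by have /andP[] := Xstar01 v v01 s.
  by have /andP[] := Xstar01 w w01 s.
by rewrite !XstarF ?t0// ratio// t0.
Qed.
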